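(* The vertex connectivity of a divisible design graph $\Gamma$ with parameters $(v,k,\lambda_1,\lambda_2,m,n)$, where $\lambda_1=k-1$ and $\lambda_2\notin\{0,2k-v\}$, equals $k-1$.
   Context: A $k$-regular graph on $v$ vertices is called a divisible design graph (DDG) with parameters $(v,k,\lambda_1,\lambda_2,m,n)$ if its vertex set can be partitioned into $m$ classes of size $n$ such that two distinct vertices from the same class have exactly $\lambda_1$ common neighbours, and two vertices from different classes have exactly $\lambda_2$ common neighbours. The vertex connectivity $\varkappa(G)$ of a graph $G$ is the minimum number of vertices whose deletion from $G$ disconnects it.
   Formalization: The theorem assumes m ≥ 2 and n ≥ 2; with n = 1 the parameter λ1 (with m = 1, λ2) is unconstrained and the claim fails, e.g. for the 4×4 rook graph with singleton classes or for complete graphs. *)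

(* Defs.v *)
From mathcomp Require Import all_boot all_order all_algebra.

Set Implicit Arguments.
Unset Strict Implicit.
Unset Printing Implicit Defensive.

Section Graphs.

Variables (T : finType) (e : rel T).

Definition simple_graph : Prop := symmetric e /\ irreflexive e.

Definition neighbours (x : T) : {set T} := [set y | e x y].

Definition regular (k : nat) : Prop := forall x, #|neighbours x| = k.

Definition common_neighbours (x y : T) : {set T} := neighbours x :&: neighbours y.

Definition divisible_classes (lambda1 lambda2 m n : nat) (P : {set {set T}}) : Prop :=
  [/\ partition P [set: T],
      #|P| = m,
      forall B, B \in P -> #|B| = n,
      forall B x y, B \in P -> x \in B -> y \in B -> x != y ->
        #|common_neighbours x y| = lambda1
    & forall B C x y, B \in P -> C \in P -> B != C -> x \in B -> y \in C ->
        #|common_neighbours x y| = lambda2].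

Definition divisible_design_graph (v k lambda1 lambda2 m n : nat) : Prop :=
  [/\ simple_graph, #|T| = v, regular k
    & exists P : {set {set T}}, divisible_classes lambda1 lambda2 m n P].

(* Keeps all of T as vertex type; edges meeting S are removed. *)
Definition delete_vertices (S : {set T}) : rel T :=
  [rel x y | [&& x \notin S, y \notin S & e x y]].

Definition disconnects (S : {set T}) : bool :=
  [exists x in ~: S, exists y in ~: S, ~~ connect (delete_vertices S) x y].

(* A disconnecting set leaves at least two vertices, so the default value
   #|T|.-1 is attained only when no set disconnects the graph, i.e. when it is
   complete (the usual convention for complete graphs). *)
Definition vertex_connectivity : nat :=
  \big[minn/#|T|.-1]_(S : {set T} | disconnects S) #|S|.

End Graphs.

(* Main.v *)
Require Import Defs.
From mathcomp Require Import all_boot all_order all_algebra.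
From mathcomp Require Import algC zify ring.

(** Write [R i j] for the number of neighbours that a vertex of class [i] has in
    class [j]; it is well defined because [lambda1 = k - 1] makes two vertices
    of a class differ in just one neighbour each, and those two neighbours
    again share a class.  Counting common neighbours gives
    [sum_j R i j * (n - R i j) = n - 1], so every row of [R] has exactly one
    entry outside [{0, n}], in a column [exc i], and [exc] is an involution of
    the classes.  Reading [R ^ 2] modulo [n ^ 2] leaves only [n = 2].

    Lower bound: counting paths of length two across a separation [A], [B] by a
    cut of size [s] (Cauchy-Schwarz) yields
    [lambda2 * |A| * |B| <= (1 + n * (k - 1 - lambda2)) * s], which together
    with the trivial bounds [|A| + s > k] and [|B| + s > k] forces [s >= k - 1].

    Upper bound: a class fixed by [exc] is an edge [x y], and the [k - 1] common
    neighbours of [x] and [y] separate [{x, y}] from the rest.  If [exc] fixed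
    no class, it would act on the 0/1 matrix [E] of full class pairs; [E]
    restricted to the [exc]-symmetric and to the [exc]-antisymmetric vectors
    gives, up to sign, integer matrices [U], [V] of equal size, congruent
    modulo 2, with [V ^ 2 + V = q] and
    [U ^ 2 + U = q + lambda2 J], both of trace 0.  Idempotents with odd
    denominators that are congruent modulo 2 are conjugate, so the odd
    eigenvalue has the same multiplicity in both, and comparing traces gives
    [lambda2 = 0]. *)

Set Implicit Arguments.
Unset Strict Implicit.
Unset Printing Implicit Defensive.

Import Order.TTheory GRing.Theory Num.Theory.
Local Open Scope ring_scope.

(** * Traces of integer matrices *)

(** A rank factorization [P = C R] of an idempotent has [R C = 1], and [tr (C R) = tr (R C)]. *)
Lemma mxtrace_idempotent (F : fieldType) (h : nat) (P : 'M[F]_h) :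
  P *m P = P -> \tr P = (\rank P)%:R.
Proof.
move=> idP; have CRP := mulmx_base P.
have [Rfree Cfull] := (row_base_free P, col_base_full P).
set C := col_base P in CRP Cfull; set R := row_base P in CRP Rfree.
clearbody C R; have RC1 : R *m C = 1%:M.
  apply: (row_free_inj Rfree); rewrite mul1mx.
  have /row_fullP[L LC] := Cfull.
  have : L *m (C *m R *m (C *m R)) = L *m (C *m R) by rewrite CRP idP.
  by rewrite !mulmxA LC !mul1mx.
by rewrite -{1}CRP mxtrace_mulC RC1 mxtrace1.
Qed.

(** [(M + s) / (2 s)] is idempotent; [x] is its rank, the multiplicity of the eigenvalue [s]. *)
Lemma mxtrace_square_scalar (F : fieldType) (h : nat) (M : 'M[F]_h) (s : F) :
  2 != 0 :> F -> s != 0 -> M *m M = (s ^+ 2)%:M ->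
  exists x : nat, \tr M = s * (x.*2%:R - h%:R).
Proof.
move=> two0 s0 MM; pose P := (2 * s)^-1 *: (M + s%:M).
have sD : (2 * s) != 0 by rewrite mulf_neq0.
have idP : P *m P = P.
  rewrite /P -scalemxAl -scalemxAr mulmxDl !mulmxDr MM -scalar_mxM.
  rewrite mul_scalar_mx mul_mx_scalar.
  have -> : (s ^+ 2)%:M + s *: M + (s *: M + (s * s)%:M) = (2 * s) *: (M + s%:M).
    by apply/matrixP=> i j; rewrite !mxE; case: (i == j); ring.
  by rewrite !scalerA -mulrA mulVf // mulr1.
have := mxtrace_idempotent idP; rewrite mxtraceZ mxtraceD mxtrace_scalar.
move=> /(congr1 (fun z => 2 * s * z)); rewrite mulrA mulfV // mul1r => trE.
exists (\rank P); rewrite -[LHS](addrK (s *+ h)) trE.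
by rewrite -[s *+ h]mulr_natl -muln2 natrM; ring.
Qed.

Lemma mxtrace_int_square_scalar (h : nat) (M : 'M[int]_h) (d : int) :
  d != 0 -> M *m M = d%:M -> exists y : int, (\tr M) ^+ 2 = y ^+ 2 * d.
Proof.
move=> d0 MM; have s2 := sqrtCK (d%:~R : algC).
have s0 : sqrtC (d%:~R : algC) != 0 by rewrite sqrtC_eq0 intr_eq0.
have two0 : 2 != 0 :> algC by rewrite pnatr_eq0.
have [|x] := @mxtrace_square_scalar algC h (map_mx intr M) _ two0 s0.
  by rewrite s2 -map_mxM MM map_scalar_mx.
rewrite trace_map_mx => trE; exists (x.*2%:Z - h%:Z).
apply: (@intr_inj algC); rewrite rmorphXn [RHS]rmorphM rmorphXn /= trE exprMn s2 mulrC.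
by rewrite rmorphB.
Qed.

Lemma mxtrace_similar (R : idomainType) (h : nat) (X P Q : 'M[R]_h) (p q : R) :
  \det X != 0 -> q *: (P *m X) = p *: (X *m Q) -> q * \tr P = p * \tr Q.
Proof.
move=> X0 /(congr1 (fun Y => \tr (Y *m \adj X))).
rewrite -!scalemxAl !mxtraceZ -[P *m X *m _]mulmxA mul_mx_adj mul_mx_scalar.
rewrite mxtrace_mulC mulmxA mul_adj_mx mul_scalar_mx !mxtraceZ.
by rewrite !(mulrCA _ (\det X)) => /(mulfI X0).
Qed.

(* The intertwiner [P Q + (1 - P) (1 - Q)] of two idempotents (here scaled by [p]
   and [q]) reduces to the identity, hence is invertible. *)
Lemma mxtrace_idem_mod (R : idomainType) (F : fieldType) (f : {rmorphism R -> F})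
    (h : nat) (P Q : 'M[R]_h) (p q : R) :
  f p = 1 -> f q = 1 -> P *m P = p *: P -> Q *m Q = q *: Q ->
  map_mx f P = map_mx f Q -> q * \tr P = p * \tr Q.
Proof.
move=> p1 q1 PP QQ PQ.
apply: (@mxtrace_similar _ _ (P *m Q + (p%:M - P) *m (q%:M - Q))).
  have : f (\det (P *m Q + (p%:M - P) *m (q%:M - Q))) != 0.
    rewrite -det_map_mx map_mxD !map_mxM !map_mxB !map_scalar_mx p1 q1 -PQ.
    have idP : map_mx f P *m map_mx f P = map_mx f P.
      by rewrite -map_mxM PP map_mxZ p1 scale1r.
    rewrite mulmxBl mul1mx mulmxBr mulmx1 idP subrr subr0 addrC subrK.
    by rewrite det1 oner_neq0.
  by apply: contraNneq => ->; rewrite rmorph0.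
set Y := (p%:M - P) *m (q%:M - Q).
have PY : P *m Y = 0.
  by rewrite /Y mulmxA (mulmxBr P) PP mul_mx_scalar subrr mul0mx.
have YQ : Y *m Q = 0.
  by rewrite /Y -mulmxA [_ *m Q]mulmxBl QQ mul_scalar_mx subrr mulmx0.
rewrite mulmxDr mulmxDl PY YQ !addr0 mulmxA PP -mulmxA QQ.
by rewrite -scalemxAl -scalemxAr !scalerA mulrC.
Qed.

(** [1 + 4 q] is the square of an integer, necessarily odd, say [2 r + 1]. *)
Lemma pronic_of_square (q y z : int) : z != 0 -> z ^+ 2 = y ^+ 2 * (1 + 4 * q) ->
  exists r : int, q = r * (r + 1).
Proof.
move=> z0 E.
have y0 : y != 0.
  by apply: contra_neq z0 => y0; apply/eqP; rewrite -sqrf_eq0 E y0 expr0n mul0r.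
have : (y %| z)%Z.
  rewrite -(@dvdz_pexp2r _ _ 2) //.
  by apply/dvdzP; exists (1 + 4 * q); rewrite E mulrC.
move=> /dvdzP[w zE]; have w2 : w ^+ 2 = 1 + 4 * q.
  have y20 : y ^+ 2 != 0 by rewrite sqrf_eq0.
  by apply: (mulfI y20); rewrite -E zE exprMn mulrC.
have wb := divz_eq w 2; set b := (w %/ 2)%Z in wb.
have [c0|c1] : (w %% 2)%Z = 0 \/ (w %% 2)%Z = 1 by lia.
  by move: w2; rewrite wb c0 => ?; exfalso; lia.
by exists b; move: w2; rewrite wb c1; lia.
Qed.

Lemma even_intr_F2 (a : int) : (2 * a)%:~R = 0 :> 'F_2.
Proof. by rewrite rmorphM /= (_ : 2%:~R = 0) ?mul0r //; apply/val_inj. Qed.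

(** The roots of [X ^ 2 + X - q] turn out to be integers; their sum [-1] makes just one of them odd.
    The scaled projections onto its eigenspaces in [V] and [U] agree modulo 2, and comparing their
    traces leaves [mu h = 0]. *)
Lemma mxtrace_parity_obstruction (h : nat) (U V W : 'M[int]_h) (q t mu : int) :
    (0 < h)%N -> U = V + W + W ->
    V *m V = q%:M - V -> U *m U = q%:M + const_mx (2 * mu) - U ->
    U *m const_mx 1 = t *: const_mx 1 :> 'M[int]_h ->
    \tr U = 0 -> \tr V = 0 -> (2 %| q)%Z -> (2 %| t)%Z ->
  mu = 0.
Proof.
move=> h0 UE VV UU UJ trU trV q2 t2.
have hz : h%:Z != 0 by lia.
have [r qr] : exists r : int, q = r * (r + 1).
  have d0 : 1 + 4 * q != 0 by lia.
  (* [(2 V + 1) ^ 2 = 1 + 4 q], and [2 V + 1] has the nonzero trace [h]. *)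
  have [|y Ey] := @mxtrace_int_square_scalar h (V + V + 1%:M) (1 + 4 * q) d0.
    rewrite mulmxDr mulmx1 mulmxDl mul1mx !mulmxDr !mulmxDl VV.
    by apply/matrixP=> i j; rewrite !mxE; case: (i == j); rewrite /=; ring.
  apply: (pronic_of_square (z := h%:Z) (y := y)) => //.
  by rewrite -Ey !mxtraceD trV mxtrace1 !add0r natz.
(* The roots of [X ^ 2 + X - q]; the odd one is called [th]. *)
have [th [th' [sE pE thE th'E]]] : exists th th' : int,
    [/\ th = - 1 - th', q = - (th * th'), (th %% 2)%Z = 1 & (2 %| th')%Z].
  have [r2|r2] := boolP (2 %| r)%Z.
    by exists (- r - 1), r; split => //; [ring | rewrite qr; ring | lia].
  by exists r, (- r - 1); split; [ring | rewrite qr; ring | lia | lia].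
(* Up to odd factors, [P] and [Q] project onto the [th]-eigenspaces; [Q] also
   has to kill the eigenvalue [t] of the all-one vector. *)
pose P := V - th'%:M; pose Q := (U - th'%:M) *m (U - t%:M).
have PP : P *m P = (th - th') *: P.
  rewrite /P mulmxBr !mulmxBl VV mul_mx_scalar mul_scalar_mx -scalar_mxM pE.
  by apply/matrixP=> i j; rewrite !mxE sE; case: (i == j); rewrite /=; ring.
have QE : (U - th%:M) *m (U - th'%:M) = const_mx (2 * mu).
  rewrite mulmxBr !mulmxBl UU mul_mx_scalar mul_scalar_mx -scalar_mxM pE.
  by apply/matrixP=> i j; rewrite !mxE sE; case: (i == j); rewrite /=; ring.
have UC : (U - t%:M) *m const_mx (2 * mu) = 0 :> 'M_h.
  have -> : const_mx (2 * mu) = (2 * mu) *: const_mx 1 :> 'M[int]_h.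
    by apply/matrixP=> i j; rewrite !mxE mulr1.
  by rewrite -scalemxAr mulmxBl UJ mul_scalar_mx subrr scaler0.
have UQ : U *m Q = th *: Q.
  apply/eqP; rewrite -subr_eq0 -mul_scalar_mx -mulmxBl /Q; apply/eqP.
  have Usw a : (U - a%:M) *m (U - t%:M) = (U - t%:M) *m (U - a%:M).
    rewrite !mulmxBr !mulmxBl !mul_mx_scalar !mul_scalar_mx.
    by apply/matrixP=> i j; rewrite !mxE; case: (i == j); rewrite /=; ring.
  by rewrite Usw mulmxA Usw -mulmxA QE UC.
have QQ : Q *m Q = ((th - th') * (th - t)) *: Q.
  rewrite {1}/Q -mulmxA [_ *m Q]mulmxBl UQ mul_scalar_mx -scalerBl -scalemxAr.
  by rewrite [_ *m Q]mulmxBl UQ mul_scalar_mx -scalerBl scalerA mulrC.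
have fodd a : (a %% 2)%Z = 1 -> intmul (1 : 'F_2) a = 1.
  move=> a1; rewrite (divz_eq a 2) a1 [(_ %/ _)%Z * 2]mulrC rmorphD /=.
  by rewrite even_intr_F2 add0r.
have feven a : (2 %| a)%Z -> intmul (1 : 'F_2) a = 0.
  by move=> /dvdzP[b ->]; rewrite mulrC even_intr_F2.
have QU : Q = U *m U - (th' + t) *: U + (th' * t)%:M.
  rewrite /Q mulmxBr !mulmxBl mul_mx_scalar mul_scalar_mx -scalar_mxM.
  by apply/matrixP=> i j; rewrite !mxE; case: (i == j); rewrite /=; ring.
(* As [th'], [t] and [q] are even, modulo 2 [P] is [V] and [Q] is [U ^ 2 = - U]. *)
have PQ : map_mx (intmul (1 : 'F_2)) P = map_mx (intmul 1) Q.
  rewrite QU.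
  have mu2 : const_mx (2 * mu) = (2 * mu) *: const_mx 1 :> 'M[int]_h.
    by apply/matrixP=> i j; rewrite !mxE mulr1.
  rewrite UU mu2 /P !(map_mxD, map_mxN, map_mxZ, map_scalar_mx) /=.
  rewrite even_intr_F2 rmorphD rmorphM /= !feven // UE.
  apply/matrixP=> i j; rewrite !mxE.
  set v := V i j; set w := W i j.
  rewrite !(mul0rn, mul0r, addr0, add0r, subr0, oppr0).
  apply/eqP; rewrite -subr_eq0 opprK -(even_intr_F2 (v + w)) -!rmorphD /=.
  by apply/eqP; congr (_%:~R); ring.
have trP : \tr P = - (th' * h%:Z).
  by rewrite raddfB /= trV mxtrace_scalar sub0r -mulr_natr natz.
have trQ : \tr Q = (q + 2 * mu + th' * t) * h%:Z.
  have trJ : \tr (const_mx (2 * mu) : 'M[int]_h) = 2 * mu * h%:Z.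
    rewrite /mxtrace; under eq_bigr do rewrite mxE.
    by rewrite sumr_const card_ord -[h%:Z in RHS]natz mulr_natr.
  rewrite QU UU !(mxtraceD, raddfN) /= mxtraceZ !mxtrace_scalar.
  rewrite trU trJ -(mulr_natr q) -(mulr_natr (th' * t)) !natz.
  by ring.
have := mxtrace_idem_mod (f := intmul (1 : 'F_2)) _ _ PP QQ PQ.
have e1 : (th - th')%:~R = 1 :> 'F_2 by rewrite rmorphB /= fodd // feven // subr0.
have e2 : (th - t)%:~R = 1 :> 'F_2 by rewrite rmorphB /= fodd // feven // subr0.
move=> /(_ e1); rewrite rmorphM /= e1 e2 mulr1 => /(_ erefl).
rewrite trP trQ -mulrA => /mulfI E.
have {}E : th - th' != 0 -> mu * h%:Z = 0.
  by move=> /E; rewrite pE => E2; nia.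
have /eqP := E ltac:(lia); rewrite mulf_eq0 (negPf hz) orbF.
by move/eqP.
Qed.

(** * Finite sums and fixed-point-free involutions *)

Lemma sum_nat_eq1 (I : finType) (a : I) : (\sum_j (j == a) = 1)%N.
Proof. by rewrite (bigD1 a) //= eqxx big1 // => j /negPf ->. Qed.

(** [Z] takes from each orbit of [g] the element enumerated first, so that sums over [I] fold onto
    [Z]. *)
Lemma involution_transversal (I : finType) (g : I -> I) :
    involutive g -> (forall i, g i != i) ->
  exists2 Z : {set I}, (forall i, (g i \in Z) = (i \notin Z)) &
    forall (M : nmodType) (F : I -> M),
      (\sum_i F i = \sum_(i in Z) (F i + F (g i)))%R.
Proof.
move=> gK g_free; pose Z := [set i | enum_rank i < enum_rank (g i)]%N.
have gZ i : (g i \in Z) = (i \notin Z).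
  rewrite !inE gK -leqNgt ltn_neqAle.
  by rewrite (inj_eq (@ord_inj _)) (inj_eq enum_rank_inj) g_free.
exists Z => // M F; rewrite (bigID (mem Z)) /= big_split /=; congr (_ + _)%R.
rewrite (reindex_inj (can_inj gK)); apply: eq_bigl => i.
by rewrite gZ negbK.
Qed.

(** * The quotient matrix *)

Section QuotientMatrix.

Local Open Scope nat_scope.

Variables (I : finType) (R : I -> I -> nat) (n k l2 : nat).
Hypothesis n_gt1 : 1 < n.
Hypothesis R_sym : forall i j, R i j = R j i.
Hypothesis R_le : forall i j, R i j <= n.
Hypothesis R_diag : forall i, R i i < n.
Hypothesis R_sum : forall i, \sum_j R i j = k.
Hypothesis R_sqr : forall i, \sum_j R i j * R i j + n = n * k + 1.
Hypothesis R_mul : forall i l, i != l -> \sum_j R i j * R l j = n * l2.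

Lemma sum_defect i : \sum_j R i j * (n - R i j) = n.-1.
Proof.
have : \sum_j R i j * (n - R i j) + \sum_j R i j * R i j = n * k.
  rewrite -big_split /= -(R_sum i) big_distrr /=; apply: eq_bigr => j _.
  by rewrite -mulnDr subnK ?R_le // mulnC.
by have := R_sqr i; lia.
Qed.

(** Positive [r], [s] with [r + s = n] satisfy [r s = n - 1 + (r - 1) (s - 1)]. One nonzero term
    thus exhausts [sum_defect], and equality forces [r = 1] or [s = 1]. *)
Lemma exceptional_class i : exists j,
  (R i j == 1) || (R i j == n.-1) /\
  forall j', j' != j -> (R i j' == 0) || (R i j' == n).
Proof.
have [j Rj] : exists j, R i j * (n - R i j) != 0.
  apply/existsP; apply: contraT => /existsPn all0.
  have := sum_defect i; rewrite big1 => [|j _]; last by apply/eqP/negPn/all0.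
  by lia.
exists j; have := sum_defect i; rewrite (bigD1 j) //=.
have [s ns] : exists s, n = R i j + s by exists (n - R i j); rewrite subnKC.
have sE : n - R i j = s by rewrite ns addKn.
move: Rj; rewrite sE muln_eq0 => /norP[r0 s0].
have big : n.-1 <= R i j * s by nia.
move=> sumE; have rest0 : \sum_(i0 | i0 != j) R i i0 * (n - R i i0) = 0 by lia.
split.
  have : (R i j).-1 * s.-1 == 0.
    by apply/eqP; move: sumE; rewrite rest0 addn0; nia.
  by rewrite muln_eq0; lia.
move=> j' j'j; move/eqP: rest0; rewrite sum_nat_eq0 => /forall_inP /(_ _ j'j).
by have := R_le i j'; rewrite muln_eq0; lia.
Qed.

(* By [exceptional_class] the default value is never taken. *)
Definition exc i := odflt i [pick j | 0 < R i j < n].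
Definition full i j := R i j == n.
Definition exc_deg i := R i (exc i).

Lemma excP i : (exc_deg i == 1) || (exc_deg i == n.-1) /\
  forall j, j != exc i -> R i j = n * full i j.
Proof.
rewrite /exc_deg /exc /full; have [j [Rj other]] := exceptional_class i.
case: pickP => [j0 /andP[j0p j0n]|/(_ j)]; last by move: Rj; lia.
have -> /= : j0 = j by apply/eqP/negPn/negP => /other; lia.
split=> // j' /other /orP[] /eqP ->; last by rewrite eqxx muln1.
by rewrite (_ : (0 == n) = false) ?muln0 //; lia.
Qed.

Lemma exc_bounds i : 0 < exc_deg i < n.
Proof. by have [+ _] := excP i; lia. Qed.

Lemma exc_unique i j : 0 < R i j < n -> j = exc i.
Proof.
move=> Rj; apply/eqP/negPn/negP => /(proj2 (excP i)).
by case: (full i j); lia.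
Qed.

Lemma excK : involutive exc.
Proof. by move=> i; apply/esym/exc_unique; rewrite R_sym; apply: exc_bounds. Qed.

Lemma exc_eq i l : (exc i == exc l) = (i == l).
Proof. exact: (can_eq excK). Qed.

Lemma full_exc i : full i (exc i) = false.
Proof. by rewrite /full; have := exc_bounds i; rewrite /exc_deg; lia. Qed.

Lemma full_diag i : full i i = false.
Proof. by rewrite /full; have := R_diag i; lia. Qed.

Lemma full_sym i j : full i j = full j i.
Proof. by rewrite /full R_sym. Qed.

Lemma R_decomp i j : R i j = n * full i j + (j == exc i) * exc_deg i.
Proof.
case: eqVneq => [->|/(proj2 (excP i)) ->]; last by rewrite addn0.
by rewrite full_exc muln0 mul1n.
Qed.

Lemma full_sum i : k = n * (\sum_j full i j) + exc_deg i.
Proof.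
rewrite -(R_sum i) (eq_bigr _ (fun j _ => R_decomp i j)) big_split /=.
by rewrite -big_distrr -big_distrl /= sum_nat_eq1 mul1n.
Qed.

(** As [exc] is injective, the exceptional entries of two rows never meet in one column, so every
    term of [R_mul] contains a factor [n], which cancels. *)
Lemma full_mul i l : i != l ->
  l2 = n * (\sum_j full i j * full l j)
       + exc_deg i * full l (exc i) + exc_deg l * full i (exc l).
Proof.
move=> il; have := R_mul il.
have RR j : R i j * R l j = n * (n * (full i j * full l j)
  + (j == exc i) * (exc_deg i * full l (exc i))
  + (j == exc l) * (exc_deg l * full i (exc l))).
  rewrite !R_decomp; have [->|ji] := eqVneq j (exc i).
    rewrite exc_eq (negPf il) full_exc; lia.
  by have [->|jl] := eqVneq j (exc l); rewrite ?full_exc; lia.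
rewrite (eq_bigr _ (fun j _ => RR j)) -big_distrr /= !big_split /=.
rewrite -big_distrr -!big_distrl /= !sum_nat_eq1 !mul1n => /eqP.
by rewrite eqn_pmul2l => [/eqP|]; lia.
Qed.

Lemma exc_deg_mod i : exc_deg i = k %% n.
Proof.
by rewrite (full_sum i) mulnC modnMDl modn_small //; case/andP: (exc_bounds i).
Qed.

(** [exc_deg i] is 1 or -1 modulo [n] and does not depend on [i], so [full_mul] fixes the sum of the
    two bits modulo [n]; being at most 2, the sum is fixed outright when [n > 2]. *)
Lemma exc_meet_const i l i' l' : 2 < n -> i != l -> i' != l' ->
  full l (exc i) + full i (exc l) = full l' (exc i') + full i' (exc l') :> nat.
Proof.
move=> n3 /full_mul E /full_mul; rewrite {1}E.
have [+ _] := excP i; rewrite !exc_deg_mod.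
have small (b c : bool) : b + c < n by case: b; case: c; lia.
move: (small (full l (exc i)) (full i (exc l))).
move: (small (full l' (exc i')) (full i' (exc l'))).
move: (\sum_j _) (\sum_j _) => u w.
move: (full l _ : nat) (full i _ : nat) (full l' _ : nat) (full i' _ : nat).
move=> b c b' c' bc' bc.
have inj x y p q : n * x + p = n * y + q -> p < n -> q < n -> p = q.
  by move=> /(congr1 (modn^~ n)); rewrite ![n * _]mulnC !modnMDl => + pn qn;
    rewrite !modn_small.
case/orP=> /eqP ->.
  by move=> eq; apply: (inj w u) => //; lia.
by move=> eq; apply/esym/(inj (w + (b + c)) (u + (b' + c'))) => //; nia.
Qed.

(** If [exc] is the identity, [full] is constant off the diagonal, and its two possible values give
    the two alternatives. If [exc] moves a class, [full] vanishes identically. *)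
Lemma large_classes_excluded : 2 < n -> 1 < #|I| -> l2 = 0 \/ l2 + n * #|I| = 2 * k.
Proof.
move=> n3 /card_gt1P[i0 [l0 [_ _ il0]]].
have [/forallP excI|] := boolP [forall i, exc i == i].
  have {}excI i : exc i = i by apply/eqP.
  have full_const i l i' l' : i != l -> i' != l' -> full i l = full i' l'.
    move=> il il'; have := exc_meet_const n3 il il'; rewrite !excI.
    by rewrite (full_sym l) (full_sym l'); do 2!case: full.
  have := full_mul il0; rewrite !excI (full_sym l0).
  have := full_sum i0; have := exc_deg_mod l0; rewrite -(exc_deg_mod i0).
  case Fil : (full i0 l0) => dE kE lE.
    right; have Fall i j : full i j = (i != j).
      have [->|/full_const] := eqVneq i j; first exact: full_diag.
      by move=> /(_ _ _ il0) ->.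
    have S1 : \sum_j full i0 j + 1 = #|I|.
      rewrite -(sum_nat_eq1 i0) -big_split /= -sum1_card; apply: eq_bigr => j _.
      by rewrite Fall (eq_sym i0); case: (j == i0).
    have S2 : \sum_j full i0 j * full l0 j + 2 = #|I|.
      rewrite -(addn1 1) -{1}(sum_nat_eq1 i0) -(sum_nat_eq1 l0) -!big_split /= -sum1_card.
      apply: eq_bigr => j _; rewrite !Fall !(eq_sym _ j).
      by have [->|] := eqVneq j i0; rewrite ?(negPf il0) //; case: (j == l0).
    rewrite -S2 kE lE dE /= !muln1.
    have -> : \sum_j full i0 j = (\sum_j full i0 j * full l0 j) + 1 by lia.
    by lia.
  have F0 i j : full i j = false.
    have [->|/full_const] := eqVneq i j; first exact: full_diag.
    by move=> /(_ _ _ il0) ->.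
  left; rewrite lE big1 => [|j _]; last by rewrite !F0.
  by rewrite !muln0.
rewrite negb_forall => /existsP[i exci].
have meet0 i' l' : i' != l' -> full l' (exc i') = false.
  move=> il'; have := exc_meet_const n3 il' exci.
  by rewrite excK !full_diag; case: full.
have F0 l j : full l j = false.
  rewrite -(excK j); have [->|/meet0 //] := eqVneq (exc j) l.
  exact: full_exc.
left; rewrite (full_mul il0) !F0 big1 => [|j _]; last by rewrite !F0.
by rewrite !muln0.
Qed.

(** * Classes of size two, none fixed by [exc] *)

Section PairClasses.

Hypothesis n2 : n = 2.
Hypothesis exc_free : forall i, exc i != i.

Lemma exc_deg1 i : exc_deg i = 1.
Proof. by have := exc_bounds i; lia. Qed.

Lemma full_exc_mul i : l2 = 2 * \sum_j full i j * full (exc i) j.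
Proof.
have := full_mul (i := i) (l := exc i); rewrite eq_sym exc_free n2 excK.
by rewrite !full_diag !muln0 !addn0 => ->.
Qed.

(** [full_exc_mul] makes [l2] even, so [full_mul] leaves an even sum of the two bits. Hence [exc] is
    an automorphism of the relation [full]. *)
Lemma full_excC i l : full l (exc i) = full i (exc l).
Proof.
have [-> //|il] := eqVneq i l.
have := full_mul il; rewrite !exc_deg1 (full_exc_mul i) n2.
by case: (full l _); case: (full i (exc l)); lia.
Qed.

Lemma full_exc2 i l : full (exc i) (exc l) = full i l.
Proof. by rewrite full_excC excK full_sym. Qed.

Lemma full_excl i l : full (exc i) l = full i (exc l).
Proof. by rewrite full_sym full_excC. Qed.

Lemma full_mul_half i l : i != l ->
  \sum_j full i j * full l j + full i (exc l) = l2./2.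
Proof.
move=> /full_mul; rewrite full_excC !exc_deg1 n2 => ->.
by case: full; lia.
Qed.

Lemma full_sqr i : \sum_j full i j * full i j = k./2.
Proof.
have -> : \sum_j full i j * full i j = \sum_j full i j.
  by apply: eq_bigr => j _; case: full.
by rewrite (full_sum i) exc_deg1 n2; lia.
Qed.

Lemma full_sum_half i : \sum_j full i j = k./2.
Proof. by rewrite (full_sum i) exc_deg1 n2; lia. Qed.

(** [exc] preserves the terms of [full_exc_mul] and has no fixed point, so they pair up. *)
Lemma even_half_l2 : I -> 2 %| l2./2.
Proof.
move=> i; have [Z _ sumZ] := involution_transversal excK exc_free.
rewrite (full_exc_mul i) mul2n doubleK (sumZ nat) /=.
apply: dvdn_sum => j _; rewrite full_exc2 full_excl.
by rewrite [(_ + _)%R](_ : _ = 2 * (full i j * full i (exc j))) ?dvdn_mulr //;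
  rewrite mul2n -addnn mulnC.
Qed.

(** Summing [full_mul_half] over [l != i] exhibits [(k / 2) ^ 2] as a multiple of the even number
    [l2 / 2]. *)
Lemma even_half_k : I -> 2 %| k./2.
Proof.
move=> i; suff : 2 %| k./2 * k./2 by rewrite Euclid_dvdM // orbb.
have : \sum_l (\sum_j full i j * full l j + full i (exc l))
    = k./2 * k./2 + k./2.
  rewrite big_split /= exchange_big /=; congr (_ + _).
    rewrite -{1}(full_sum_half i) big_distrl; apply: eq_bigr => j _ /=.
    rewrite -big_distrr -(full_sum_half j) /=; congr (_ * _).
    by apply: eq_bigr => l _; rewrite full_sym.
  by rewrite -(full_sum_half i) [RHS](reindex_inj (can_inj excK)).
rewrite (bigD1 i) //= full_sqr full_exc addn0.
rewrite (eq_bigr (fun=> l2./2)) => [|l]; last by rewrite eq_sym => /full_mul_half.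
rewrite sum_nat_const => /eqP; rewrite addnC eqn_add2r => /eqP <-.
by rewrite dvdn_mull // even_half_l2.
Qed.

Local Open Scope ring_scope.

(** For the matrix [E] of [full], [full_mul_half] reads [E ^ 2 = q + (l2 / 2) J - E X], where [X] is
    the permutation matrix of [exc]. As [X] acts as 1 or -1 on the two kinds of vectors, this yields
    the equations of [mxtrace_parity_obstruction] on a transversal [Z]. *)
Lemma fixed_point_free_exc : I -> l2 = 0%N.
Proof.
move=> i0; have [Z gZ sumZ] := involution_transversal excK exc_free.
have Z0 : (0 < #|Z|)%N.
  apply/card_gt0P; have := gZ i0; have [|_] := boolP (i0 \in Z); first by exists i0.
  by exists (exc i0).
pose z (a : 'I_#|Z|) := enum_val a.
have zZ a : z a \in Z by apply: enum_valP.
pose EE i l : int := \sum_j (full i j)%:Z * (full l j)%:Z.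
pose q : int := (k./2)%:Z - (l2./2)%:Z.
have EEne i l : i != l -> EE i l = (l2./2)%:Z - (full i (exc l))%:Z.
  move=> /full_mul_half <-; rewrite PoszD addrK /EE.
  by rewrite (big_morph Posz PoszD (erefl _)); apply: eq_bigr => j _; rewrite PoszM.
have EEeq i : EE i i = (k./2)%:Z.
  rewrite -(full_sqr i) (big_morph Posz PoszD (erefl _)).
  by apply: eq_bigr => j _; rewrite PoszM.
have zexc a b : z a != exc (z b).
  by apply: contraTneq (zZ a) => ->; rewrite gZ zZ.
have zinj a b : (z a == z b) = (a == b) by rewrite (inj_eq enum_val_inj).
(* [V + S + S] is the matrix [U] of the header; [V] carries the opposite sign of
   the restriction to antisymmetric vectors. *)
pose S := \matrix_(a, b) (full (z a) (z b))%:Z.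
pose V := \matrix_(a, b) ((full (z a) (exc (z b)))%:Z - (full (z a) (z b))%:Z).
have VV a b : (V *m V) a b = EE (z a) (z b) - EE (z a) (exc (z b)).
  rewrite /EE -sumrB (sumZ int) mxE [RHS]big_enum_val /=.
  apply: eq_bigr => c _; rewrite !mxE -/(z c) !full_exc2.
  by rewrite !full_excl (full_excC (z b) (z c)) (full_sym (z c) (z b)); ring.
have UU a b : ((V + S + S) *m (V + S + S)) a b
    = EE (z a) (z b) + EE (z a) (exc (z b)).
  rewrite /EE -big_split (sumZ int) mxE [RHS]big_enum_val /=.
  apply: eq_bigr => c _; rewrite !mxE -/(z c) !full_exc2.
  by rewrite !full_excl (full_excC (z b) (z c)) (full_sym (z c) (z b)); ring.
have q2 : (2 %| q)%Z by have := even_half_l2 i0; have := even_half_k i0; lia.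
have mu0 : (l2./2)%:Z = 0.
  apply: (@mxtrace_parity_obstruction _ (V + S + S) V S q (k./2)%:Z _ Z0) => //.
  - apply/matrixP=> a b; rewrite VV [in RHS]mxE [in RHS]mxE [in RHS]mxE -zinj.
    rewrite [EE _ (exc _)]EEne // excK mxE; have [->|ab] := eqVneq (z a) (z b).
      by rewrite EEeq full_diag full_exc /q; lia.
    by rewrite EEne // mulr0n; ring.
  - apply/matrixP=> a b; rewrite UU !mxE -zinj.
    rewrite [EE _ (exc _)]EEne // excK; have [->|ab] := eqVneq (z a) (z b).
      by rewrite EEeq full_diag full_exc /q; lia.
    by rewrite EEne // mulr0n; ring.
  - apply/matrixP=> a b; rewrite !mxE -(full_sum_half (z a)) mulr1.
    rewrite (big_morph Posz PoszD (erefl _)) (sumZ int) [RHS]big_enum_val /=.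
    by apply: eq_bigr => c _; rewrite !mxE -/(z c); ring.
  - by rewrite /mxtrace big1 // => a _; rewrite !mxE full_diag full_exc.
  - by rewrite /mxtrace big1 // => a _; rewrite !mxE full_diag full_exc.
  - by have := even_half_k i0; lia.
by have := full_exc_mul i0; lia.
Qed.

End PairClasses.

Lemma exc_has_fixed_point : n = 2 -> (0 < #|I|)%N -> l2 != 0%N ->
  exists i, exc i = i.
Proof.
move=> n2 /card_gt0P[i0 _] l2n0.
have [/existsP[i /eqP ei]|] := boolP [exists i, exc i == i]; first by exists i.
rewrite negb_exists => /forallP fr; case/eqP: l2n0.
exact: (fixed_point_free_exc n2 fr i0).
Qed.

End QuotientMatrix.

(** * Vertex cuts *)

Section Connectivity.

Local Open Scope nat_scope.

Variables (T : finType) (e : rel T).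
Hypothesis e_irr : irreflexive e.

Lemma vertex_connectivity_le (S : {set T}) :
  disconnects e S -> vertex_connectivity e <= #|S|.
Proof. exact: (@bigmin_le_cond _ nat _ _ S (disconnects e) (fun S => #|S|)). Qed.

(** The bound by [#|T|.-1] covers the default value of the minimum. *)
Lemma vertex_connectivity_ge d : d <= #|T|.-1 ->
  (forall S, disconnects e S -> d <= #|S|) -> d <= vertex_connectivity e.
Proof.
move=> dT dS; apply: (big_ind (fun x => d <= x)) => // x y dx dy.
by rewrite leq_min dx.
Qed.

(** Once [S] is deleted, the edge [x y] is a component of its own; the cardinality bound leaves a
    third vertex outside [S]. *)
Lemma closed_twins_disconnect x y (S : {set T}) : e x y -> #|S|.+2 < #|T| ->
  neighbours e x :\ y = S -> neighbours e y :\ x = S -> disconnects e S.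
Proof.
move=> exy ST xS yS.
have [xnS ynS] : x \notin S /\ y \notin S.
  by split; [rewrite -yS | rewrite -xS]; rewrite !inE eqxx.
have [z] : exists z, z \in ~: (S :|: [set x; y]).
  apply/card_gt0P; have := cardsC (S :|: [set x; y]).
  have := (leq_card_setU S [set x; y]).1; rewrite cards2.
  by case: (x != y); lia.
rewrite in_setC in_setU negb_or in_set2 => /andP[znS zxy].
apply/exists_inP; exists x; first by rewrite inE.
apply/exists_inP; exists z; first by rewrite inE.
apply: contra zxy => /connectP[p pth ->].
have closed u w : delete_vertices e S u w -> (u == x) || (u == y) ->
    (w == x) || (w == y).
  move=> /and3P[_ wnS euw] uxy; apply: contraR wnS; rewrite negb_or => /andP[wx wy].
  by case/orP: uxy euw => /eqP -> euw; [rewrite -xS | rewrite -yS]; rewrite !inE euw ?wx ?wy.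
suff stay u : path (delete_vertices e S) u p -> (u == x) || (u == y) ->
    (last u p == x) || (last u p == y) by apply: stay; rewrite ?eqxx.
elim: p u {pth} => [|w p IH] u //= /andP[uw pth] /(closed _ _ uw).
exact: IH.
Qed.

Lemma disconnects_separation (S : {set T}) : disconnects e S ->
  exists A B : {set T}, [/\ A != set0, B != set0, [disjoint A & B],
    #|T| = #|A| + #|B| + #|S| & forall a b, a \in A -> b \in B -> ~~ e a b].
Proof.
move=> /exists_inP[x]; rewrite inE => xS /exists_inP[y]; rewrite inE => yS nxy.
pose K := [set z | connect (delete_vertices e S) x z].
exists (~: S :&: K), (~: S :\: K); split.
- by apply/set0Pn; exists x; rewrite !inE xS connect0.
- by apply/set0Pn; exists y; rewrite !inE yS nxy.
- by rewrite -setI_eq0; apply/eqP/setP => z; rewrite !inE; case: (connect _ _ _); rewrite ?andbF.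
- by rewrite cardsID addnC cardsC.
move=> a b; rewrite !inE => /andP[aS xa] /andP[xb bS].
apply: contra xb => ab; apply: connect_trans xa (connect1 _).
by rewrite /delete_vertices /= aS bS.
Qed.

Lemma separation_degree k (A B S : {set T}) : regular e k -> A != set0 -> [disjoint A & B] ->
  #|T| = #|A| + #|B| + #|S| -> (forall a b, a \in A -> b \in B -> ~~ e a b) ->
  k < #|A| + #|S|.
Proof.
move=> reg /set0Pn[x xA] dAB cT AB.
have : neighbours e x \subset ~: B :\ x.
  apply/subsetP=> y; rewrite !inE => exy; apply/andP; split.
    by apply: contraTneq exy => ->; rewrite e_irr.
  by apply: contraL exy => /(AB _ _ xA).
move/subset_leq_card; rewrite reg; have := cardsD1 x (~: B); have := cardsC B.
rewrite inE (disjointFr dAB xA).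
lia.
Qed.

(** If [s <= k - 2], the degree bounds give [p, w >= 3], hence [p * w >= 3 * (p + w) - 9]. The
    vertex count expresses [l2 * (p + w)] through [s], and the resulting bound, linear in [s],
    fails. *)
Lemma cut_size_lower_bound k l2 p w s : l2.+1 < k -> l2 * p * w <= (1 + 2 * (k.-1 - l2)) * s ->
  k * k + 2 + 2 * l2 = 2 * k + 1 + l2 * (p + w + s) ->
  k < p + s -> k < w + s -> k.-1 <= s.
Proof.
move=> l2k le1 kk kp kw; rewrite leqNgt; apply/negP => sk.
have [c kE] : exists c, k = l2 + c.+2 by exists (k - l2.+2); lia.
have [p' pE] : exists p', p = p' + 3 by exists (p - 3); lia.
have [w' wE] : exists w', w = w' + 3 by exists (w - 3); lia.
have k1E : k.-1 - l2 = c.+1 by lia.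
have sle : s <= l2 + c by lia.
have h3 : (3 * l2 + (2 * c + 3)) * s <= (3 * l2 + (2 * c + 3)) * (l2 + c).
  by rewrite leq_mul2l sle orbT.
have pw : l2 * p * w = l2 * (p' * w') + 3 * (l2 * p) + 3 * (l2 * w) - 9 * l2.
  rewrite pE wE; lia.
move: le1 kk h3; rewrite k1E pw kE => le1 kk h3.
lia.
Qed.

End Connectivity.

(** * Divisible designs *)

Lemma sum_sqr_le (T : finType) (A : {set T}) (F : T -> nat) :
  ((\sum_(u in A) F u) ^ 2 <= #|A| * \sum_(u in A) F u ^ 2)%N.
Proof.
rewrite -(leq_pmul2l (isT : (0 < 2)%N)).
have -> : (2 * (\sum_(u in A) F u) ^ 2
    = \sum_(u in A) \sum_(w in A) 2 * (F u * F w))%N.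
  rewrite -mulnn big_distrlr big_distrr; apply: eq_bigr => u _ /=.
  by rewrite big_distrr.
have -> : (2 * (#|A| * \sum_(u in A) F u ^ 2)
    = \sum_(u in A) \sum_(w in A) (F u ^ 2 + F w ^ 2))%N.
  under [RHS]eq_bigr do rewrite big_split /= sum_nat_const.
  by rewrite big_split /= sum_nat_const -big_distrr /= mul2n addnn.
by do 2![apply: leq_sum => ? _]; apply: nat_Cauchy.
Qed.

Lemma card_setI_sum (T : finType) (A B : {set T}) : (#|A :&: B| = \sum_(x in A) (x \in B))%N.
Proof.
rewrite -sum1_card big_mkcond [RHS]big_mkcond; apply: eq_bigr => x _.
by rewrite inE; case: (x \in A); case: (x \in B).
Qed.

Section DivisibleDesign.

Local Open Scope nat_scope.

Variables (T I : finType) (e : rel T) (cl : T -> I) (rep : I -> T) (n k l2 : nat).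
Hypothesis e_sym : symmetric e.
Hypothesis e_irr : irreflexive e.
Hypothesis e_reg : regular e k.
Hypothesis n_gt1 : 1 < n.
Hypothesis k_gt0 : 0 < k.
Hypothesis repK : cancel rep cl.
Hypothesis card_cl : forall i, #|[set x | cl x == i]| = n.
Hypothesis common_same : forall x y, x != y -> cl x = cl y ->
  #|common_neighbours e x y| = k.-1.
Hypothesis common_diff : forall x y, cl x != cl y ->
  #|common_neighbours e x y| = l2.

Notation N := (neighbours e).
Notation C := (fun i => [set x | cl x == i]).

Lemma nbrE x y : (y \in N x) = e x y. Proof. by rewrite inE. Qed.

Lemma nbr_sym x y : (y \in N x) = (x \in N y). Proof. by rewrite !inE e_sym. Qed.

Lemma sum_class (F : T -> nat) : \sum_x F x = \sum_j \sum_(x in C j) F x.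
Proof.
rewrite (partition_big cl predT) //=; apply: eq_bigr => j _.
by apply: eq_bigl => x; rewrite inE.
Qed.

(** One formula for the entries of the squared adjacency matrix; the terms to be subtracted stand on
    the left, since subtraction truncates. *)
Lemma card_commonE x y :
  #|common_neighbours e x y| + (cl x == cl y) * l2.+1
    = l2 + (cl x == cl y) * k + (x == y).
Proof.
have [<-|xy] := eqVneq x y.
  by rewrite eqxx /common_neighbours setIid e_reg; lia.
by have [cxy|/common_diff ->] := eqVneq (cl x) (cl y); rewrite ?common_same //; lia.
Qed.

Lemma sum_commonE x (W : {set T}) :
  \sum_(y in W) #|common_neighbours e x y| + #|W :&: C (cl x)| * l2.+1
    = #|W| * l2 + #|W :&: C (cl x)| * k + (x \in W).
Proof.
have cW : #|W :&: C (cl x)| = \sum_(y in W) (cl x == cl y).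
  by rewrite card_setI_sum; apply: eq_bigr => y _; rewrite inE eq_sym.
have xW : (x \in W) = \sum_(y in W) (x == y) :> nat.
  transitivity #|W :&: [set x]|.
    have [xW|xW] := boolP (x \in W).
      by rewrite (setIidPr _) ?cards1 // sub1set.
    by apply/esym/eqP; rewrite cards_eq0 setI_eq0 disjoint_sym disjoints1.
  by rewrite card_setI_sum; apply: eq_bigr => y _; rewrite inE eq_sym.
rewrite cW xW -sum_nat_const !big_distrl /= -!big_split /=.
by apply: eq_bigr => y _; rewrite card_commonE.
Qed.

Lemma degree_count : I -> k * k + n + n * l2 = n * k + 1 + l2 * #|T|.
Proof.
move=> i; have := sum_commonE (rep i) setT.
rewrite setTI card_cl inE cardsT.
have -> : \sum_(y in setT) #|common_neighbours e (rep i) y| = k * k.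
  rewrite /common_neighbours; under eq_bigr do rewrite card_setI_sum.
  rewrite exchange_big /= -{1}(e_reg (rep i)) -sum_nat_const; apply: eq_bigr => u _.
  rewrite -(e_reg u) -(setTI (N u)) card_setI_sum.
  by apply: eq_bigr => y _; rewrite nbr_sym.
lia.
Qed.

(** The number [q u] of neighbours of [u] in [B] vanishes on [A], so Cauchy-Schwarz runs over only
    [#|B| + s] vertices. The second moment counts common neighbours of pairs in [B], and
    [degree_count] rewrites [k ^ 2]. *)
Lemma separation_bound (A B : {set T}) (s : nat) : l2 < k ->
  (forall x y, x \in A -> y \in B -> ~~ e x y) -> #|T| = #|A| + #|B| + s ->
  l2 * #|A| * #|B| <= (1 + n * (k.-1 - l2)) * s.
Proof.
move=> l2k AB vE; have [->|[z zB]] := set_0Vmem B; first by rewrite cards0 muln0.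
have B0 : 0 < #|B| by apply/card_gt0P; exists z.
pose q u := #|B :&: N u|.
have qA u : u \in A -> q u = 0.
  move=> uA; apply/eqP; rewrite cards_eq0; apply/eqP/setP => y; rewrite !inE.
  by case yB : (y \in B) => //=; apply/negbTE/AB.
have sumq : \sum_(u in ~: A) q u = k * #|B|.
  transitivity (\sum_u q u).
    rewrite [RHS](bigID (mem A)) /= [X in _ = X + _]big1 ?add0n //.
    by apply: eq_bigl => u; rewrite inE.
  under eq_bigr do rewrite /q card_setI_sum.
  rewrite exchange_big mulnC -sum_nat_const /=; apply: eq_bigr => y _.
  rewrite -(e_reg y) -(setTI (N y)) card_setI_sum.
  by apply: eq_big => u; [rewrite inE | rewrite nbr_sym].
have sumq2 : \sum_(u in ~: A) q u ^ 2 <= #|B| * (l2 * #|B| + (1 + n * (k.-1 - l2))).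
  have -> : \sum_(u in ~: A) q u ^ 2
      = \sum_(y in B) \sum_(y' in B) #|common_neighbours e y y'|.
    transitivity (\sum_u q u ^ 2).
      rewrite [RHS](bigID (mem A)) /= [X in _ = X + _]big1 ?add0n; last first.
        by move=> u /qA ->.
      by apply: eq_bigl => u; rewrite inE.
    have qE u : q u ^ 2 = \sum_(y in B) \sum_(y' in B) (u \in N y) * (u \in N y').
      rewrite -mulnn /q card_setI_sum big_distrlr /=.
      by apply: eq_bigr => y _; apply: eq_bigr => y' _; rewrite !(nbr_sym u).
    under eq_bigr do rewrite qE.
    rewrite exchange_big; apply: eq_bigr => y _ /=.
    rewrite exchange_big; apply: eq_bigr => y' _ /=.
    rewrite /common_neighbours -(setTI (_ :&: _)) card_setI_sum.
    by apply: eq_big => u; [rewrite inE | rewrite in_setI mulnb].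
  rewrite -sum_nat_const; apply: leq_sum => y yB.
  have := sum_commonE y B; rewrite yB.
  have : #|B :&: C (cl y)| <= n by rewrite -(card_cl (cl y)) subset_leq_card // subsetIr.
  move: #|_ :&: _| => b bn.
  have [c kE] : exists c, k = l2 + c.+1 by exists (k - l2.+1); lia.
  by rewrite kE; nia.
have := sum_sqr_le (~: A) q; rewrite sumq.
have -> : #|~: A| = #|B| + s by have := cardsC A; lia.
move=> le1; have {le1 sumq2} : (k * #|B|) ^ 2
    <= (#|B| + s) * (#|B| * (l2 * #|B| + (1 + n * (k.-1 - l2)))).
  exact: leq_trans le1 (leq_mul (leqnn _) sumq2).
have := degree_count (cl z); rewrite vE.
have [c kE] : exists c, k = l2 + c.+1 by exists (k - l2.+1); lia.
have -> : k.-1 - l2 = c by lia.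
move=> kk; have nk : n * k = n * l2 + n * c + n by rewrite kE mulnDr mulnS; lia.
have {nk}kk : k * k = 1 + n * c + l2 * (#|A| + #|B| + s) by lia.
have -> : (k * #|B|) ^ 2 = (#|B| * #|B|) * (k * k) by ring.
rewrite kk -mulnA [(_ + s) * (_ * _)]mulnCA leq_pmul2l // => le2.
nia.
Qed.

Hypothesis I_gt1 : 1 < #|I|.
Hypothesis l2_neq0 : l2 != 0.
Hypothesis l2_neq : l2 + #|T| != 2 * k.

Lemma card_vertices : #|T| = n * #|I|.
Proof.
rewrite -sum1_card sum_class (eq_bigr (fun=> n)).
  by rewrite sum_nat_const mulnC.
by move=> i _; rewrite sum1_card card_cl.
Qed.

Lemma degree_lt : I -> k < #|T|.
Proof.
move=> i; rewrite -(e_reg (rep i)) -cardsT proper_card //; apply/properP.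
by split; [exact: subsetT | exists (rep i); rewrite !inE // e_irr].
Qed.

Lemma lambda2_lt : l2.+1 < k.
Proof.
have /card_gt1P[i [j [_ _ ij]]] := I_gt1.
have l2k : l2 <= k.
  rewrite -(common_diff (x := rep i) (y := rep j)) ?repK //.
  by rewrite -(e_reg (rep i)) subset_leq_card // subsetIl.
have kv := degree_lt i; have vE := card_vertices.
have := degree_count i.
have v2n : 2 * n <= #|T| by rewrite vE; nia.
move=> kk; rewrite ltnNge; apply/negP => kl2.
have [l2E|l2E] : l2 = k \/ l2.+1 = k by lia.
  by move: kk; rewrite l2E; nia.
(* [k = 1] would give [l2 = 0], and [#|T| = k + 1] would give [l2 + #|T| = 2 k]. *)
have : k.-1 * (#|T| - k.+1) == 0.
  by apply/eqP; move: kk; rewrite -l2E; nia.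
by rewrite muln_eq0; lia.
Qed.

Lemma private_neighbour x y : x != y -> cl x = cl y -> exists a, N x :\: N y = [set a].
Proof.
move=> xy cxy; apply/cards1P/eqP.
have := cardsID (N y) (N x); rewrite (common_same xy cxy) e_reg; lia.
Qed.

(** Otherwise, take a neighbour [z] of [a] other than [x]: it has as many common neighbours with [x]
    as with [y], so it is adjacent to [b] too. Then [a] and [b] share [k - 1] neighbours, more than
    [l2]. *)
Lemma private_neighbours_same_class x y a b : x != y -> cl x = cl y ->
  N x :\: N y = [set a] -> N y :\: N x = [set b] -> cl a = cl b.
Proof.
move=> xy cxy aE bE; apply/eqP; apply: contraT => cab.
have /setDP[ax ay] : a \in N x :\: N y by rewrite aE set11.
have /setDP[yb xb] : b \in N y :\: N x by rewrite bE set11.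
have ab : common_neighbours e a b = N a :\ x.
  apply/setP=> z; rewrite in_setD1 in_setI; apply/andP/andP => -[].
    by move=> za zb; split=> //; apply: contraNneq xb => <-; rewrite nbr_sym.
  move=> zx za; split=> //; rewrite nbr_sym.
  have zy : z != y by apply: contraNneq ay => <-; rewrite nbr_sym.
  have zxy : #|common_neighbours e z x| = #|common_neighbours e z y|.
    have [czx|czx] := eqVneq (cl z) (cl x).
      by rewrite !common_same // -cxy.
    by rewrite !common_diff // -cxy.
  have : #|N z :&: [set a]| = #|N z :&: [set b]|.
    move: zxy; rewrite /common_neighbours.
    rewrite -(cardsID (N y) (N z :&: N x)) -(cardsID (N x) (N z :&: N y)).
    by rewrite -!setIDA aE bE setIAC => /addnI.
  have -> : N z :&: [set a] = [set a].
    by apply/setIidPr; rewrite sub1set nbr_sym.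
  rewrite cards1 => /esym /eqP/cards1P[c /setP/(_ c)]; rewrite set11.
  by case/setIP => bz /set1P <-.
have := common_diff cab; rewrite ab.
have := cardsD1 x (N a); rewrite -nbr_sym ax e_reg; have := lambda2_lt; lia.
Qed.

(** * The quotient matrix of the graph *)

Definition class_deg x j := #|N x :&: C j|.

(** Passing from [x] to [y] exchanges one neighbour [a] for some [b] of the same class. *)
Lemma class_deg_cl x y j : cl x = cl y -> class_deg x j = class_deg y j.
Proof.
move=> cxy; have [-> //|xy] := eqVneq x y.
have [a aE] := private_neighbour xy cxy.
have [b bE] : exists b, N y :\: N x = [set b].
  by apply: private_neighbour => //; rewrite eq_sym.
have cab := private_neighbours_same_class xy cxy aE bE.
rewrite /class_deg -(cardsID (N y) (N x :&: C j)) -(cardsID (N x) (N y :&: C j)).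
rewrite ![_ :&: C j]setIC -!setIDA aE bE -!setIA [N y :&: N x]setIC; congr (_ + _).
have card1 c : #|C j :&: [set c]| = (cl c == j).
  have [cj|cj] := boolP (cl c == j).
    by rewrite (setIidPr _) ?cards1 // sub1set inE.
  by apply/eqP; rewrite cards_eq0 setI_eq0 disjoint_sym disjoints1 inE.
by rewrite !card1 cab.
Qed.

Definition Q i j := class_deg (rep i) j.

Lemma class_degE x j : class_deg x j = Q (cl x) j.
Proof. by apply: class_deg_cl; rewrite repK. Qed.

Lemma Q_sym i j : Q i j = Q j i.
Proof.
have dc : \sum_(x in C i) class_deg x j = \sum_(y in C j) class_deg y i.
  rewrite /class_deg; under eq_bigr do rewrite setIC card_setI_sum.
  rewrite exchange_big /=; apply: eq_bigr => y _.
  by rewrite setIC card_setI_sum; apply: eq_bigr => x _; rewrite nbr_sym.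
have cst i' j' : \sum_(x in C i') class_deg x j' = n * Q i' j'.
  rewrite (eq_bigr (fun=> Q i' j')) ?sum_nat_const ?card_cl // => x.
  by rewrite inE => /eqP <-; rewrite class_degE.
by move/eqP: dc; rewrite !cst eqn_pmul2l; [move/eqP | lia].
Qed.

Lemma Q_le i j : Q i j <= n.
Proof. by rewrite -(card_cl j) subset_leq_card // subsetIr. Qed.

Lemma Q_diag i : Q i i < n.
Proof.
rewrite -(card_cl i) proper_card //; apply/properP; split; first exact: subsetIr.
by exists (rep i); rewrite !inE ?repK ?eqxx // e_irr.
Qed.

Lemma Q_sum i : \sum_j Q i j = k.
Proof.
rewrite -(e_reg (rep i)) -[RHS]sum1_card [RHS]big_mkcond [RHS]sum_class; apply: eq_bigr => j _.
by rewrite /Q /class_deg setIC card_setI_sum; apply: eq_bigr => x _; case: (_ \in _).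
Qed.

Lemma sum_common x l :
  \sum_(z in C l) #|common_neighbours e x z| = \sum_j Q (cl x) j * Q j l.
Proof.
under eq_bigr do rewrite /common_neighbours card_setI_sum.
rewrite exchange_big /= big_mkcond /= sum_class; apply: eq_bigr => j _.
rewrite -class_degE /class_deg setIC card_setI_sum big_distrl /=.
apply: eq_bigr => u; rewrite inE => /eqP <-; case: (u \in N x) => //.
rewrite mul1n -class_degE /class_deg setIC card_setI_sum.
by apply: eq_bigr => z _; rewrite nbr_sym.
Qed.

Lemma Q_mul i l : i != l -> \sum_j Q i j * Q l j = n * l2.
Proof.
move=> il; rewrite (eq_bigr (fun j => Q (cl (rep i)) j * Q j l)); last first.
  by move=> j _; rewrite repK (Q_sym l).
rewrite -sum_common (eq_bigr (fun=> l2)) ?sum_nat_const ?card_cl // => z.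
by rewrite inE => /eqP zl; rewrite common_diff // repK zl.
Qed.

(** From [rep i] there are [k] walks of length two back to itself and [k - 1] to each other vertex
    of its class. *)
Lemma Q_sqr i : \sum_j Q i j * Q i j + n = n * k + 1.
Proof.
rewrite (eq_bigr (fun j => Q (cl (rep i)) j * Q j i)); last first.
  by move=> j _; rewrite repK (Q_sym j).
rewrite -sum_common (bigD1 (rep i)) ?inE ?repK //=.
have -> : #|common_neighbours e (rep i) (rep i)| = k.
  by rewrite /common_neighbours setIid.
rewrite (eq_bigr (fun=> k.-1)); last first.
  move=> z /andP[]; rewrite inE => /eqP zi z_rep.
  by rewrite common_same ?repK // eq_sym.
rewrite sum_nat_cond_const.
have -> : [set x in C i | x != rep i] = C i :\ rep i.
  by apply/setP=> z; rewrite !inE andbC.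
by have := cardsD1 (rep i) (C i); rewrite card_cl inE repK eqxx; nia.
Qed.

Theorem labelled_connectivity : vertex_connectivity e = k.-1.
Proof.
have l2k := lambda2_lt.
have /card_gt1P[i0 _] := I_gt1.
have kv := degree_lt i0; have vE := card_vertices.
(* For [n > 2] only the two excluded values of [l2] would remain. *)
have n2 : n = 2.
  apply/eqP; rewrite eqn_leq n_gt1 andbT leqNgt; apply/negP => n3.
  have [|] := large_classes_excluded n_gt1 Q_sym Q_le Q_diag Q_sum Q_sqr Q_mul
    n3 I_gt1; first by lia.
  by rewrite -vE; lia.
have [i exci] := exc_has_fixed_point n_gt1 Q_sym Q_le Q_diag Q_sum Q_sqr Q_mul
  n2 (ltnW I_gt1) l2_neq0.
have count := degree_count i; rewrite n2 in count.
(* In a complete graph the count would force [k = 1] or [l2 = k - 1]. The strict bound later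
   supplies a vertex beyond the twins and their common neighbours. *)
have kv1 : k.+1 < #|T|.
  rewrite ltn_neqAle kv andbT; apply/eqP => vk.
  have [c kE] : exists c, k = l2 + c.+2 by exists (k - l2.+2); lia.
  by move: count; rewrite -vk kE; nia.
apply/eqP; rewrite eqn_leq; apply/andP; split; last first.
  apply: vertex_connectivity_ge => [|S disS]; first by lia.
  have [A [B [A0 B0 dAB cT AB]]] := disconnects_separation disS.
  have BA b a : b \in B -> a \in A -> ~~ e b a by rewrite e_sym => bB /AB; apply.
  have := separation_bound (ltnW l2k) AB cT; rewrite n2 => bnd.
  apply: (cut_size_lower_bound l2k bnd); first by rewrite count cT.
    exact: (separation_degree e_irr e_reg A0 dAB cT AB).
  apply: (separation_degree e_irr e_reg B0 _ _ BA); first by rewrite disjoint_sym.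
  by rewrite cT [#|A| + _]addnC.
(* A class fixed by [exc] has a positive diagonal entry, hence an edge inside it. *)
have [y] : exists y, y \in N (rep i) :&: C i.
  apply/card_gt0P; have := exc_bounds n_gt1 Q_le Q_sum Q_sqr i.
  by rewrite /exc_deg exci => /andP[].
rewrite inE nbrE => /andP[xy]; rewrite inE => /eqP cy.
set x := rep i in xy; have x_y : x != y by apply: contraTneq xy => ->; rewrite e_irr.
have cxy : cl x = cl y by rewrite cy repK.
have twin u w : e u w -> u != w -> cl u = cl w ->
    N u :\ w = common_neighbours e u w.
  move=> uw u_w cuw; have [a aE] := private_neighbour u_w cuw.
  have wa : w = a by apply/set1P; rewrite -aE !inE uw e_irr.
  apply/setP=> z; move/setP/(_ z): aE; rewrite -wa !inE.
  by case: (z == w); case: (e u z); case: (e w z).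
rewrite -(common_same x_y cxy); apply: vertex_connectivity_le.
apply: (closed_twins_disconnect xy); last 2 first.
- exact: twin.
- by rewrite twin 1?eq_sym 1?e_sym // /common_neighbours setIC.
by rewrite common_same //; lia.
Qed.

End DivisibleDesign.

Theorem proposition8 (T : finType) (e : rel T) (v k lambda1 lambda2 m n : nat)
    (Hddg : divisible_design_graph e v k lambda1 lambda2 m n)
    (Hm : (1 < m)%N) (Hn : (1 < n)%N)
    (Hlambda1 : lambda1%:Z = k%:Z - 1)
    (Hlambda2 : lambda2%:Z \notin [:: 0; 2 * k%:Z - v%:Z]) :
  (vertex_connectivity e)%:Z = k%:Z - 1.
Proof.
have [[e_sym e_irr] vE e_reg [P [partP cardP cardB same diff]]] := Hddg.
have k_gt0 : (0 < k)%N by lia.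
have cover_in x : x \in cover P by rewrite (cover_partition partP).
have trivP : trivIset P by case/and3P: partP.
(* The blocks, made into a finite type, index the quotient matrix. *)
pose I := {B : {set T} | B \in P}.
pose cl x : I := Sub (pblock P x) (pblock_mem (cover_in x)).
have clE (B : I) x : (cl x == B) = (x \in val B).
  rewrite -val_eqE /= eq_sym; apply/eqP/idP => [->|xB].
    by rewrite mem_pblock.
  by apply/esym/def_pblock => //; apply: valP.
have [rep repK] : exists rep : I -> T, cancel rep cl.
  have : forall B : I, exists x, cl x = B.
    move=> B; have /card_gt0P[x xB] : (0 < #|val B|)%N by rewrite (cardB _ (valP B)) ltnW.
    by exists x; apply/eqP; rewrite clE.
  by move/fin_all_exists => [rep repK]; exists rep.
suff : vertex_connectivity e = k.-1 by lia.
apply: (labelled_connectivity (cl := cl) (rep := rep) (n := n) (l2 := lambda2)) => //.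
- move=> B; rewrite -(cardB _ (valP B)); apply: eq_card => x.
  by rewrite inE clE.
- move=> x y xy /(congr1 val) /= cxy.
  have -> : k.-1 = lambda1 by lia.
  apply: (same (pblock P x)) => //; first exact: pblock_mem.
    by rewrite mem_pblock.
  by rewrite cxy mem_pblock.
- move=> x y; rewrite -val_eqE /= => cxy.
  by apply: (diff (pblock P x) (pblock P y)); rewrite ?pblock_mem ?mem_pblock.
- by rewrite card_sig cardP.
- by apply: contraNneq Hlambda2 => ->; rewrite inE eqxx.
apply: contraNneq Hlambda2; rewrite vE => E; rewrite !inE; apply/orP; right.
by apply/eqP; lia.
Qed.
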